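(* Let $R$ be a commutative local ring whose maximal ideal $\mathfrak{m}$ is principal with $\mathfrak{m}^2 = 0$. Then for all integers $i, j, i', j' \geq 0$, \[ \Sigma^{i'} E_{j'} \gg \Sigma^i E_j \iff (i,j) \leq (i',j'), \] where pairs are ordered lexicographically: $(i,j) < (i',j')$ if $i < i'$, or $i = i'$ and $j < j'$. Moreover, let $X$ be a perfect chain complex over $R$, written as $X \cong P \oplus Q$ with $P$ acyclic and $Q$ a finite direct sum of complexes $\Sigma^i E_j$; let $S_X$ be the set of pairs $(i,j)$ such that $\Sigma^i E_j$ appears as a summand of $Q$, and let $(i_X, j_X)$ be the minimal element of $S_X$ in the lexicographic order. Then $\mathcal{C}(X) = \mathcal{C}(\Sigma^{i_X} E_{j_X})$, unless $X$ is contractible, in which case $\mathcal{C}(X) = \mathcal{C}(0)$.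
   Context: Fix a generator $r$ of $\mathfrak{m}$. Chain complexes are non-negatively graded chain complexes of $R$-modules, with differentials lowering degree. A weak equivalence is a chain map inducing an isomorphism on homology. A chain complex is perfect if it consists of projective modules in each degree and $\bigoplus_i X_i$ is finitely generated; every perfect complex admits a decomposition $X \cong P \oplus Q$ as described in the claim. For integers $i, j \geq 0$, $\Sigma^i E_j$ is the complex with $(\Sigma^i E_j)_n = R$ for $i \leq n \leq i+j$ and $0$ otherwise, with every differential $R \to R$ given by multiplication by $(-1)^i r$ (its isomorphism type does not depend on $r$). For a chain complex $A$, $\mathcal{C}(A)$ denotes the smallest collection of chain complexes that (1) contains $A$, (2) is closed under arbitrary direct sums and under weak equivalences, and (3) whenever $0 \to X \to Y \to Z \to 0$ is a short exact sequence of chain complexes with $X, Y \in \mathcal{C}(A)$, also $Z \in \mathcal{C}(A)$. One writes $Y \gg A$ if $Y \in \mathcal{C}(A)$.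
   Formalization: The formal theorem assumes the maximal ideal m is nonzero (its generator r is not 0), so R is not a field; over a field E_0 is a direct summand of E_1, so E_0 ≫ E_1 although (0,1) > (0,0), and the stated equivalence fails. *)

(* Defs.v *)
From HB Require Import structures.
From mathcomp Require Import all_boot all_order all_algebra.
From Stdlib Require List.
Set Implicit Arguments. Unset Strict Implicit. Unset Printing Implicit Defensive.
Import GRing.Theory.
Local Open Scope ring_scope.

Section Complexes.
Variable R : comUnitRingType.

Record complex := Complex {
  cobj :> nat -> lmodType R;
  cd : forall n, {linear cobj n.+1 -> cobj n};
  cdd : forall n (x : cobj n.+2), cd n (cd n.+1 x) = 0 }.

Record chain_map (X Y : complex) := ChainMap {
  cm :> forall n, {linear X n -> Y n};
  cm_comm : forall n (x : X n.+1), cm n (cd X n x) = cd Y n (cm n.+1 x) }.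

Definition is_cycle (X : complex) (n : nat) : X n -> Prop :=
  match n return X n -> Prop with
  | 0 => fun _ => True
  | m.+1 => fun x => cd X m x = 0
  end.

Definition is_boundary (X : complex) (n : nat) (x : X n) : Prop :=
  exists z : X n.+1, cd X n z = x.

(* f induces an isomorphism H_n(X) -> H_n(Y) for every n (injective and surjective) *)
Definition weak_equiv (X Y : complex) (f : chain_map X Y) : Prop :=
  forall n,
    (forall x : X n, is_cycle x -> is_boundary (f n x) -> is_boundary x) /\
    (forall y : Y n, is_cycle y ->
        exists x : X n, is_cycle x /\ is_boundary (f n x - y)).

Definition acyclic (X : complex) : Prop :=
  forall n (x : X n), is_cycle x -> is_boundary x.

Definition is_direct_sum (Y : complex) (I : Type) (F : I -> complex) : Prop :=
  exists iota : forall k, chain_map (F k) Y,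
    (forall n (y : Y n), exists (ks : seq I) (x : forall k, F k n),
        y = \sum_(k <- ks) iota k n (x k)) /\
    (forall n (ks : seq I) (x : forall k, F k n), List.NoDup ks ->
        \sum_(k <- ks) iota k n (x k) = 0 -> forall k, List.In k ks -> x k = 0).

Definition short_exact (X Y Z : complex) (f : chain_map X Y) (g : chain_map Y Z)
  : Prop :=
  forall n,
    (forall x x' : X n, f n x = f n x' -> x = x') /\
    (forall z : Z n, exists y : Y n, g n y = z) /\
    (forall y : Y n, g n y = 0 <-> exists x : X n, f n x = y).

(* C(A): the smallest collection containing A, closed under arbitrary direct
   sums, weak equivalences and cokernels of short exact sequences.
   Cl A Y  means  Y \in C(A), i.e. Y >> A. *)
Inductive Cl (A : complex) : complex -> Prop :=
| Cl_base : Cl A A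
| Cl_sum : forall (Y : complex) (I : Type) (F : I -> complex),
    is_direct_sum Y F -> (forall k, Cl A (F k)) -> Cl A Y
| Cl_weq_fwd : forall (X Y : complex) (f : chain_map X Y),
    weak_equiv f -> Cl A X -> Cl A Y
| Cl_weq_bwd : forall (X Y : complex) (f : chain_map X Y),
    weak_equiv f -> Cl A Y -> Cl A X
| Cl_coker : forall (X Y Z : complex) (f : chain_map X Y) (g : chain_map Y Z),
    short_exact f g -> Cl A X -> Cl A Y -> Cl A Z.

Definition projective (P : lmodType R) : Prop :=
  forall (M N : lmodType R) (g : {linear M -> N}) (f : {linear P -> N}),
    (forall y : N, exists x : M, g x = y) ->
    exists h : {linear P -> M}, forall p : P, g (h p) = f p.

Definition fin_gen (M : lmodType R) : Prop :=
  exists s : seq M, forall x : M, exists c : nat -> R,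
    x = \sum_(k < size s) c k *: nth 0 s k.

(* perfect: projective in each degree and (+)_n X_n finitely generated,
   i.e. X bounded with each X_n finitely generated *)
Definition perfect (X : complex) : Prop :=
  (forall n, projective (X n)) /\
  (exists N : nat, forall n, (N <= n)%N -> forall x : X n, x = 0) /\
  (forall n, fin_gen (X n)).

Definition contractible (X : complex) : Prop :=
  exists h : forall n, {linear X n -> X n.+1},
    (forall x : X 0, x = cd X 0 (h 0 x)) /\
    (forall m (x : X m.+1), x = cd X m.+1 (h m.+1 x) + h m (cd X m x)).

Definition rowcx (dim : nat -> nat) (M : forall n, 'M[R]_(dim n.+1, dim n))
  (hM : forall n, M n.+1 *m M n = 0) : complex.
Proof.
refine (@Complex (fun n => ('rV[R]_(dim n) : lmodType R)) (fun n => mulmxr (M n)) _).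
by move=> n x /=; rewrite -mulmxA hM mulmx0.
Defined.

Lemma zero_cx_proof : forall n : nat, (0 : 'M[R]_(0, 0)) *m (0 : 'M[R]_(0, 0)) = 0.
Proof. by move=> n; rewrite mulmx0. Qed.

Definition zero_cx : complex := @rowcx (fun _ => 0%N) (fun _ => 0) zero_cx_proof.

Section SigmaE.
Variables (r : R) (hr : r * r = 0).

Definition SE_dim (i j n : nat) : nat := if (i <= n <= i + j)%N then 1%N else 0%N.

Lemma SE_proof (i j : nat) :
  forall n, (const_mx ((-1) ^+ i * r) : 'M[R]_(SE_dim i j n.+2, SE_dim i j n.+1))
     *m (const_mx ((-1) ^+ i * r) : 'M[R]_(SE_dim i j n.+1, SE_dim i j n)) = 0.
Proof.
move=> n; apply/matrixP => a b; rewrite !mxE; apply: big1 => k _.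
by rewrite !mxE mulrACA hr mulr0.
Qed.

Definition SigmaE (i j : nat) : complex :=
  @rowcx (SE_dim i j) (fun n => const_mx ((-1) ^+ i * r)) (SE_proof i j).
End SigmaE.

End Complexes.

Definition lexle (p q : nat * nat) : bool :=
  (p.1 < q.1)%N || ((p.1 == q.1) && (p.2 <= q.2)%N).

(* Main.v *)
(* Cones of maps between members of C(A) lie in C(A), and so do retracts of
   members.  The cone of the map E_j -> Sigma E_j which is the identity in degrees
   1..j is equivalent to Sigma R (+) Sigma^(j+1) R, so Sigma R, and with it every
   suspension of R, lies in C(E_j); attaching one copy of R on top of E_j gives
   E_(j+1).  Conversely, every X in C(Sigma^i E_j) has no homology below degree i,
   and every cycle x of degree i extends to a sequence x = x_0, .., x_j with
   d x_(k+1) = r x_k; the bottom generator of Sigma^i E_j' has no such extension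
   when j' < j.  The second part follows because each summand of X is a retract of
   X and acyclic complexes lie in every C(A). *)
Require Import Defs.
From HB Require Import structures.
From mathcomp Require Import all_boot all_order all_algebra.
From mathcomp Require Import boolp functions.
From mathcomp Require Import ring zify.
From Stdlib Require List.
Set Implicit Arguments. Unset Strict Implicit. Unset Printing Implicit Defensive.
Import GRing.Theory.
Local Open Scope ring_scope.

(** * Elementary closure properties of [Cl] *)

Section Cellular.
Variable R : comUnitRingType.
Implicit Types A B X Y Z : complex R.

Definition to_linear (U V : lmodType R) (f : U -> V) (lin_f : linear f) :
  {linear U -> V} :=
  let M := GRing.isLinear.Build R U V _ f lin_f in HB.pack f M.

Lemma Cl_trans A B Y : Cl A B -> Cl B Y -> Cl A Y.
Proof.
move=> AB; elim=> //.
- by move=> Y' I F sumF _ ClF; apply: Cl_sum sumF ClF.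
- by move=> X' Y' f wf _; apply: Cl_weq_fwd wf.
- by move=> X' Y' f wf _; apply: Cl_weq_bwd wf.
- by move=> X' Y' Z' f g fg _ CX _ CY; apply: Cl_coker fg CX CY.
Qed.

Lemma zero_map_comm X Y n (x : X n.+1) :
  (\0 : {linear X n -> Y n}) (cd X n x) = cd Y n ((\0 : {linear _ -> _}) x).
Proof. by rewrite /= linear0. Qed.

Definition zero_map X Y : chain_map X Y := ChainMap (@zero_map_comm X Y).

(** The direct sum of the empty family is zero, so closure under sums already produces it. *)
Lemma Cl_zero A : Cl A (zero_cx R).
Proof.
apply: (@Cl_sum R A _ False (fun=> A)) => //.
exists (fun k : False => match k with end); split => [n y|n ks x _ _ []].
by exists nil, (fun k : False => match k with end); rewrite big_nil; apply/rowP => -[].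
Qed.

Lemma Cl_acyclic A X : acyclic X -> Cl A X.
Proof.
move=> acX; apply: (@Cl_weq_bwd R A X (zero_cx R) (zero_map _ _)); last exact: Cl_zero.
move=> n; split=> [x cx _|y _]; first exact: acX.
exists 0; split; first by case: n {y} => //= n; rewrite linear0.
by exists 0; apply/rowP => -[].
Qed.

Lemma contractible_acyclic X : contractible X -> acyclic X.
Proof.
move=> [h [h0 hS]] [|n] x /= cx; first by exists (h 0 x).
by exists (h n.+1 x); rewrite {2}(hS n x) cx linear0 addr0.
Qed.

Lemma Cl_iso A X Y (f : chain_map X Y) :
  (forall n, injective (f n)) -> (forall n (y : Y n), exists x, f n x = y) ->
  Cl A X -> Cl A Y.
Proof.
move=> inj_f surj_f; apply: (@Cl_weq_fwd R A X Y f) => n.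
split=> [x _ [z zx]|y cy].
  have [w wz] := surj_f _ z; exists w; apply: inj_f.
  by rewrite cm_comm wz.
have [x xy] := surj_f _ y; exists x; split; last by exists 0; rewrite linear0 xy subrr.
case: n y cy x xy => //= n y cy x xy; apply: inj_f.
by rewrite cm_comm xy cy linear0.
Qed.

(** * Mapping cones and mapping cylinders *)

Definition shift_obj X (n : nat) : lmodType R :=
  if n is m.+1 then X m else 'rV[R]_0.

Definition shift_d X n : {linear shift_obj X n.+1 -> shift_obj X n} :=
  match n return {linear shift_obj X n.+1 -> shift_obj X n} with
  | 0 => \0
  | m.+1 => cd X m
  end.

Lemma shift_dd X n (x : shift_obj X n.+2) : shift_d X n (shift_d X n.+1 x) = 0.
Proof. by case: n x => [//|n] x; exact: cdd. Qed.

Section Cone.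
Variables (X Y : complex R) (f : chain_map X Y).

Definition cone_d_fun n (p : (Y n.+1 * shift_obj X n.+1)%type) :
  (Y n * shift_obj X n)%type :=
  (cd Y n p.1 + f n p.2, - shift_d X n p.2).

Lemma cone_d_linear n : linear (@cone_d_fun n).
Proof.
move=> a [y x] [y' x']; rewrite /cone_d_fun /=; congr pair.
  by rewrite !linearP /= scalerDr addrACA.
by rewrite !linearP.
Qed.

Lemma cone_dd n (p : (Y n.+2 * shift_obj X n.+2)%type) :
  to_linear (@cone_d_linear n) (to_linear (@cone_d_linear n.+1) p) = 0.
Proof.
case: p => y x; rewrite /= /cone_d_fun /=; congr pair.
  by rewrite linearD cdd add0r linearN -cm_comm subrr.
by rewrite linearN shift_dd !oppr0.
Qed.

Definition cone : complex R :=
  @Complex R (fun n => (Y n * shift_obj X n)%type) _ cone_dd.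
End Cone.

Section Cylinder.
Variables (X Y : complex R) (f : chain_map X Y).

Definition pair_d_fun n (p : (Y n.+1 * X n.+1)%type) : (Y n * X n)%type :=
  (cd Y n p.1, cd X n p.2).

Lemma pair_d_linear n : linear (@pair_d_fun n).
Proof. by move=> a [y x] [y' x']; congr pair; rewrite linearP. Qed.

Lemma pair_dd n p : to_linear (@pair_d_linear n) (to_linear (@pair_d_linear n.+1) p) = 0.
Proof. by rewrite /= /pair_d_fun /= !cdd. Qed.

Definition pair_cx : complex R :=
  @Complex R (fun n => (Y n * X n)%type) _ pair_dd.

Definition graph_fun n (x : X n) : pair_cx n := (f n x, - x).

Lemma graph_linear n : linear (@graph_fun n).
Proof. by move=> a x y; rewrite /graph_fun; congr pair; rewrite linearP. Qed.

Lemma graph_comm n (x : X n.+1) :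
  to_linear (@graph_linear n) (cd X n x) = cd pair_cx n (to_linear (@graph_linear n.+1) x).
Proof. by rewrite /= /graph_fun /pair_d_fun /= cm_comm linearN. Qed.

(** The mapping cylinder of [f], encoded as the cone of [x |-> (f x, - x)] so that the cone
    differential is reused. *)
Definition cyl : complex R := cone (ChainMap graph_comm).

Definition cyl_in_fun n (y : Y n) : cyl n := ((y, 0), 0).

Lemma cyl_in_linear n : linear (@cyl_in_fun n).
Proof. by move=> a x y; congr pair; first congr pair; rewrite /= ?scaler0 ?addr0. Qed.

Lemma cyl_in_comm n (y : Y n.+1) :
  to_linear (@cyl_in_linear n) (cd Y n y) = cd cyl n (to_linear (@cyl_in_linear n.+1) y).
Proof.
rewrite /= /cone_d_fun /= /pair_d_fun /graph_fun /cyl_in_fun /=.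
congr pair; last by rewrite linear0 oppr0.
by congr pair; rewrite /= ?linear0 ?oppr0 ?addr0.
Qed.

Definition cyl_in : chain_map Y cyl := ChainMap cyl_in_comm.

(** The cylinder retracts onto [Y] by [((y, x), s) |-> y + f x]; a cycle differs from its retraction
    by the boundary of [((0, 0), x)]. *)
Lemma cyl_in_weq : weak_equiv cyl_in.
Proof.
move=> n; split=> [y cy [[[y' x'] s]]|].
  case=> -[dy dx] _; exists (y' + f _ x').
  by rewrite linearD -cm_comm -dy (_ : cd X n x' = s) //; apply/eqP; rewrite -subr_eq0 dx.
case=> [[y x] s] cyc; exists (y + f n x).
have dxs : shift_d X n x = s.
  case: n y x s cyc => [|n] y x s; first by move=> _; apply/rowP => -[].
  by case=> -[_ /eqP]; rewrite subr_eq0 => /eqP.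
split.
  case: n y x s cyc dxs => //= n y x s [[cy _] _] xs.
  by rewrite linearD -cm_comm xs.
exists ((0, 0), x); rewrite /= /cone_d_fun /= /pair_d_fun /graph_fun /cyl_in_fun /=.
by rewrite !linear0 dxs; congr pair; [congr pair|]; rewrite /= !add0r // addrAC subrr add0r.
Qed.

End Cylinder.

(** The inclusion of [X] at the other end of the cylinder is injective with cokernel the cone, and
    the cylinder is weakly equivalent to [Y]. *)
Lemma Cl_cone A X Y (f : chain_map X Y) : Cl A X -> Cl A Y -> Cl A (cone f).
Proof.
move=> ClX ClY.
have ClC : Cl A (cyl f) by apply: Cl_weq_fwd ClY; exact: cyl_in_weq.
have in_lin n : linear (fun x : X n => (((0, x), 0) : cyl f n)).
  by move=> a x y; congr pair; [congr pair|]; rewrite /= ?scaler0 ?addr0.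
have in_comm n (x : X n.+1) :
    to_linear (in_lin n) (cd X n x) = cd (cyl f) n (to_linear (in_lin n.+1) x).
  rewrite /= /cone_d_fun /= /pair_d_fun /graph_fun /=.
  by rewrite !linear0 !addr0.
have out_lin n : linear (fun c : cyl f n => ((c.1.1, c.2) : cone f n)).
  by move=> a x y.
have out_comm n (c : cyl f n.+1) :
    to_linear (out_lin n) (cd (cyl f) n c) = cd (cone f) n (to_linear (out_lin n.+1) c).
  by [].
apply: (@Cl_coker R A X (cyl f) (cone f) (ChainMap in_comm) (ChainMap out_comm)) => // n.
split=> [x x' [->]//|]; split=> [[y s]|[[y x] s]]; first by exists ((y, 0), s).
by split=> [[/= -> ->]|[x' [<- _ <-]]//]; exists x.
Qed.

(** * Finitely supported sequences *)

Section FinSupp.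
Variable V : lmodType R.

Definition finitely_supported : {pred nat -> V} :=
  [pred w | `[< exists N, forall k, (N <= k)%N -> w k = 0 >]].

Lemma finitely_supportedP (w : nat -> V) :
  reflect (exists N, forall k, (N <= k)%N -> w k = 0) (w \in finitely_supported).
Proof. exact: asboolP. Qed.

Lemma finitely_supported_submod : GRing.submod_closed finitely_supported.
Proof.
split; first by apply/finitely_supportedP; exists 0.
move=> a v w /finitely_supportedP[M vM] /finitely_supportedP[N wN].
apply/finitely_supportedP; exists (maxn M N) => k; rewrite geq_max => /andP[Mk Nk].
change (a *: v k + w k = 0).
by rewrite vM // wN // scaler0 addr0.
Qed.

HB.instance Definition _ :=
  GRing.isSubmodClosed.Build R (nat -> V) finitely_supported finitely_supported_submod.

Record finsupp := FinSupp { finsupp_val :> nat -> V; _ : finsupp_val \in finitely_supported }.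

HB.instance Definition _ := [isSub for finsupp_val].
HB.instance Definition _ := [Choice of finsupp by <:].
HB.instance Definition _ := [SubChoice_isSubLmodule of finsupp by <:].

Lemma finsupp_ext (v w : finsupp) : (forall k, v k = w k) -> v = w.
Proof. by move=> vw; apply: val_inj; apply: funext. Qed.

Lemma finsuppD (v w : finsupp) k : (v + w) k = v k + w k.
Proof. by []. Qed.

Lemma finsuppZ a (v : finsupp) k : (a *: v) k = a *: v k.
Proof. by []. Qed.

Lemma finsupp_sum (I : Type) (s : seq I) (F : I -> finsupp) k :
  (\sum_(i <- s) F i) k = \sum_(i <- s) F i k.
Proof. by elim: s => [|i s IH]; rewrite ?big_nil // !big_cons finsuppD IH. Qed.

Lemma finsupp_bound (w : finsupp) : exists N, forall k, (N <= k)%N -> w k = 0.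
Proof. by case: w => w /= /finitely_supportedP. Qed.

Definition finsupp_of (w : nat -> V) (N : nat) (wN : forall k, (N <= k)%N -> w k = 0) :
  finsupp := FinSupp (introT (finitely_supportedP w) (ex_intro _ N wN)).

Definition single_fun (k : nat) (v : V) (l : nat) : V := if l == k then v else 0.

Lemma single_bound k v l : (k.+1 <= l)%N -> single_fun k v l = 0.
Proof. by rewrite /single_fun; case: eqP => // ->; rewrite ltnn. Qed.

Definition single k v : finsupp := finsupp_of (@single_bound k v).

Lemma single_linear k : linear (single k).
Proof.
move=> a u v; apply: finsupp_ext => l; rewrite finsuppD finsuppZ /= /single_fun.
by case: eqP; rewrite // scaler0 addr0.
Qed.

(** The fold map from the countable direct sum of [V] to [V]. The cut-off is picked by choice; by
    [totalE] any bound on the support gives the same value. *)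
Definition total (w : finsupp) : V := \sum_(k < sval (cid (finsupp_bound w))) w k.

Lemma sum_bound (w : nat -> V) (M N : nat) :
  (forall k, (M <= k)%N -> w k = 0) -> (forall k, (N <= k)%N -> w k = 0) ->
  \sum_(k < M) w k = \sum_(k < N) w k.
Proof.
wlog leMN : M N / (M <= N)%N => [wl wM wN|wM _].
  by case: (leqP M N) => [|/ltnW] le; [|apply: esym]; apply: wl.
rewrite -!(big_mkord xpredT w) [RHS](big_cat_nat (leq0n M) leMN) //=.
by rewrite [X in _ + X]big1_seq ?addr0 // => k; rewrite mem_index_iota => /andP[_ /andP[/wM]].
Qed.

Lemma totalE (w : finsupp) N : (forall k, (N <= k)%N -> w k = 0) ->
  total w = \sum_(k < N) w k.
Proof. by move=> wN; rewrite /total; case: cid => M wM; exact: sum_bound. Qed.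

Lemma total_linear : linear total.
Proof.
move=> a v w; have [M vM] := finsupp_bound v; have [N wN] := finsupp_bound w.
have vK k : (maxn M N <= k)%N -> v k = 0 by rewrite geq_max => /andP[/vM].
have wK k : (maxn M N <= k)%N -> w k = 0 by rewrite geq_max => /andP[_ /wN].
rewrite (totalE vK) (totalE wK) (@totalE _ (maxn M N)).
  by rewrite scaler_sumr -big_split.
by move=> k lek; rewrite finsuppD finsuppZ vK // wK // scaler0 addr0.
Qed.

Lemma total_single v k : total (single k v) = v.
Proof.
rewrite (@totalE (single k v) _ (@single_bound k v)) big_ord_recr /=.
rewrite big1 ?add0r /single_fun ?eqxx //.
by case=> l ltlk _ /=; rewrite ltn_eqF.
Qed.

End FinSupp.

Lemma map_bound (U V : lmodType R) (f : {linear U -> V}) (w : finsupp U) :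
  exists N, forall k, (N <= k)%N -> f (w k) = 0.
Proof. by have [N wN] := finsupp_bound w; exists N => k /wN ->; rewrite linear0. Qed.

Definition finsupp_map (U V : lmodType R) (f : {linear U -> V}) (w : finsupp U) :
  finsupp V := FinSupp (introT (finitely_supportedP _) (map_bound f w)).

Lemma finsupp_map_linear (U V : lmodType R) (f : {linear U -> V}) :
  linear (finsupp_map f).
Proof.
by move=> a v w; apply: finsupp_ext => k; rewrite finsuppD finsuppZ /= -linearP.
Qed.

Lemma total_map (U V : lmodType R) (f : {linear U -> V}) (w : finsupp U) :
  total (finsupp_map f w) = f (total w).
Proof.
have [N wN] := finsupp_bound w; rewrite (totalE wN) (@totalE _ _ N) ?linear_sum //.
by move=> k /wN /= ->; rewrite linear0.
Qed.

(** * Countable copowers and retracts *)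

Section Copower.
Variable Y : complex R.

Lemma copower_dd n (w : finsupp (Y n.+2)) :
  to_linear (finsupp_map_linear (cd Y n)) (to_linear (finsupp_map_linear (cd Y n.+1)) w) = 0.
Proof. by apply: finsupp_ext => k; rewrite /= cdd. Qed.

Definition copower : complex R :=
  @Complex R (fun n => finsupp (Y n)) _ copower_dd.

Lemma single_comm k n (y : Y n.+1) :
  to_linear (@single_linear _ k) (cd Y n y) = cd copower n (to_linear (@single_linear _ k) y).
Proof.
apply: finsupp_ext => l; rewrite /= /single_fun.
by case: eqP => //; rewrite linear0.
Qed.

Definition copower_in (k : nat) : chain_map Y copower :=
  @ChainMap R Y copower (fun n => to_linear (@single_linear (Y n) k)) (@single_comm k).

End Copower.

Lemma In_mem (T : eqType) (x : T) (s : seq T) : List.In x s <-> x \in s.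
Proof.
elim: s => //= y t IH; rewrite inE; split.
  by case=> [->|/IH ->]; rewrite ?eqxx ?orbT.
by case/orP => [/eqP ->|/IH]; [left|right].
Qed.

Lemma NoDup_uniq (T : eqType) (s : seq T) : List.NoDup s <-> uniq s.
Proof.
split; first by elim=> //= x t /In_mem/negP -> _ ->.
elim: s => [_|x s IH /= /andP[xs /IH us]]; constructor => //.
by move/In_mem; apply/negP.
Qed.

Lemma copower_direct_sum Y : is_direct_sum (copower Y) (fun _ : nat => Y).
Proof.
exists (@copower_in Y); split => [n w|n ks x /NoDup_uniq uks sum0 k /In_mem kks].
  have [N wN] := finsupp_bound w; exists (iota 0 N), w.
  apply: finsupp_ext => l; rewrite finsupp_sum /= /single_fun.
  case: (leqP N l) => [lNl|ltlN].
    rewrite wN // big1_seq // => k; rewrite mem_iota /= add0n => ltkN.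
    by rewrite gtn_eqF // (leq_trans ltkN).
  rewrite (bigD1_seq l) ?iota_uniq ?mem_iota //= eqxx big1 ?addr0 // => k.
  by rewrite eq_sym => /negPf ->.
have := congr1 (fun w : finsupp (Y n) => w k) sum0.
rewrite finsupp_sum (bigD1_seq k) //= /single_fun eqxx big1 ?addr0 // => l.
by rewrite eq_sym => /negPf ->.
Qed.

(* Telescope: [X] is the colimit of [Y -> Y -> ...] along the idempotent [e p],
   hence the cokernel of [1 - shift (e p)] on the countable copower of [Y]. *)
Lemma Cl_retract A X Y (e : chain_map X Y) (p : chain_map Y X) :
  (forall n x, p n (e n x) = x) -> Cl A Y -> Cl A X.
Proof.
move=> pe ClY.
have ClW : Cl A (copower Y) by apply: Cl_sum (@copower_direct_sum Y) _.
pose q n y := e n (p n y).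
pose tele n (w : nat -> Y n) k := w k - if k is l.+1 then q n (w l) else 0.
have tele_fin n (w : finsupp (Y n)) : exists N, forall k, (N <= k)%N -> tele n w k = 0.
  have [N wN] := finsupp_bound w; exists N.+1 => -[|k] // leNk; rewrite /tele /q;
  by move: (wN k leNk) (wN k.+1 (ltnW leNk)) => -> ->; rewrite !linear0 addr0.
pose T n (w : finsupp (Y n)) : finsupp (Y n) :=
  FinSupp (introT (finitely_supportedP _) (tele_fin n w)).
have T_lin n : linear (T n).
  move=> a v w; apply: finsupp_ext => -[|k].
    change (a *: v 0 + w 0 - 0 = a *: (v 0 - 0) + (w 0 - 0)).
    by rewrite !subr0.
  change (a *: v k.+1 + w k.+1 - q n (a *: v k + w k) =
          a *: (v k.+1 - q n (v k)) + (w k.+1 - q n (w k))).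
  have -> : q n (a *: v k + w k) = a *: q n (v k) + q n (w k) by rewrite /q !linearP.
  by rewrite scalerBr opprD addrACA.
have T_comm n (w : copower Y n.+1) :
    to_linear (T_lin n) (cd (copower Y) n w) = cd (copower Y) n (to_linear (T_lin n.+1) w).
  apply: finsupp_ext => k; rewrite /= /tele linearB /=; congr (_ - _).
  by case: k => [|k]; rewrite ?linear0 // /q -!cm_comm.
have S_lin n : linear (fun w : finsupp (Y n) => p n (total w)).
  by move=> a v w; rewrite total_linear linearP.
have S_comm n (w : copower Y n.+1) :
    to_linear (S_lin n) (cd (copower Y) n w) = cd X n (to_linear (S_lin n.+1) w).
  by rewrite /= total_map cm_comm.
apply: (@Cl_coker R A _ _ _ 
  (@ChainMap R (copower Y) (copower Y) (fun n => to_linear (T_lin n)) T_comm)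
  (@ChainMap R (copower Y) X (fun n => to_linear (S_lin n)) S_comm)) => // n.
(* [T] is injective by induction on the index: entry [k.+1] of the argument is determined once entry
   [k] is known. *)
split=> [v w /(congr1 (fun u : finsupp (Y n) => (u : nat -> _))) /= vw|].
  apply: finsupp_ext => k; elim: k => [|k IH].
    by have := congr1 (@^~ 0) vw; rewrite /tele !subr0.
  by have := congr1 (@^~ k.+1) vw; rewrite /= /tele IH => /addIr.
split=> [x|w]; first by exists (single 0 (e n x)); rewrite /= total_single pe.
have [N wN] := finsupp_bound w.
split=> /= [Sw|[v <-]].
  (* Solving [v (k+1) - q (v k) = w (k+1)] recursively, with [q] idempotent, gives
     [v k = w k + q (w 0 + .. + w (k-1))]. This vanishes for large [k] because [p] kills the total
     of [w]. *)
  pose sum_to k := \sum_(l < k) w l.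
  have v_fin k : (N <= k)%N -> w k + q n (sum_to k) = 0.
    move=> leNk; rewrite wN // add0r /q /sum_to (@sum_bound _ w k N) //.
      by rewrite -(totalE wN) Sw linear0.
    by move=> l lekl; rewrite wN // (leq_trans leNk).
  exists (finsupp_of v_fin); apply: finsupp_ext => -[|k]; rewrite /= /tele /=.
    by rewrite /q /sum_to big_ord0 !linear0 !addr0.
  have -> : q n (w k + q n (sum_to k)) = q n (sum_to k.+1).
    by rewrite /sum_to big_ord_recr /= /q addrC !linearD /= pe.
  by rewrite addrK.
(* Conversely, the total of [T v] telescopes to a sum of terms [v k - q (v k)], each killed by
   [p]. *)
have [M vM] := finsupp_bound v.
rewrite (@totalE _ (T n v) M.+1) /=; last first.
  by case=> // k ltMk; rewrite /tele /q (vM k) // (vM k.+1 (ltnW ltMk)) !linear0 addr0.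

rewrite sumrB [X in _ - X]big_ord_recl add0r big_ord_recr /= vM // addr0.
by rewrite -sumrB linear_sum big1 // => k _; rewrite linearB /q /= pe subrr.
Qed.
End Cellular.

(** * Cellular constructions between the complexes [Sigma^i E_j] *)

Section Intervals.
Variables (R : comUnitRingType) (r : R) (hr : r * r = 0).
Local Notation E := (SigmaE hr).

(** Maps between interval complexes are encoded as right multiplication by constant matrices of size
    at most one. In a composite the factor [*+ m] records whether the middle module is [R] or
    zero. *)
Lemma mulmx_const2 (l m n : nat) (x : 'rV[R]_l) (a b : R) :
  x *m (const_mx a : 'M_(l, m)) *m (const_mx b : 'M_(m, n)) = x *m const_mx (a * b *+ m).
Proof.
rewrite -mulmxA; congr (_ *m _); apply/matrixP => p q; rewrite !mxE.
by under eq_bigr do rewrite !mxE; rewrite sumr_const card_ord.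
Qed.

Lemma mulmx_const_eq (m n : nat) (x : 'rV[R]_m) (a b : R) :
  ((0 < m)%N -> (0 < n)%N -> a = b) ->
  x *m (const_mx a : 'M_(m, n)) = x *m const_mx b.
Proof.
move=> ab; congr (_ *m _); apply/matrixP => p q; rewrite !mxE; apply: ab.
  by case: (m) p => [[]|].
by case: (n) q => [[]|].
Qed.

Lemma mulmx_const0 (m n : nat) (x : 'rV[R]_m) : x *m (const_mx 0 : 'M_(m, n)) = 0.
Proof. by rewrite (_ : const_mx 0 = 0) ?mulmx0. Qed.

Lemma mulmx_const1 (m : nat) (x : 'rV[R]_m) : (m <= 1)%N -> x *m const_mx 1 = x.
Proof.
case: m x => [|[|//]] x _; apply/rowP => k; first by case: k.
by rewrite !mxE big_ord1 !mxE mulr1 !ord1.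
Qed.

Lemma SE_dim_le1 i j n : (SE_dim i j n <= 1)%N.
Proof. by rewrite /SE_dim; case: ifP. Qed.

Lemma SE_dE i j n (x : E i j n.+1) : cd (E i j) n x = x *m const_mx ((-1) ^+ i * r).
Proof. by []. Qed.

(** Suspending [E i j] gives modules convertible to those of [E i.+1 j], but only after a case split
    on the degree; hence the two identity branches. *)
Definition unshift i j n : {linear shift_obj (E i j) n -> E i.+1 j n} :=
  match n return {linear shift_obj (E i j) n -> E i.+1 j n} with
  | 0 => idfun
  | m.+1 => idfun
  end.

Definition reshift i j n : {linear E i.+1 j n -> shift_obj (E i j) n} :=
  match n return {linear E i.+1 j n -> shift_obj (E i j) n} with
  | 0 => idfun
  | m.+1 => idfun
  end.

Lemma reshiftK i j n : cancel (@reshift i j n) (@unshift i j n).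
Proof. by case: n. Qed.

Lemma unshiftK i j n : cancel (@unshift i j n) (@reshift i j n).
Proof. by case: n. Qed.

Lemma unshift_d i j n (s : shift_obj (E i j) n.+1) :
  unshift i j n (- shift_d (E i j) n s) = cd (E i.+1 j) n s.
Proof.
case: n s => [|n] s; first by apply/rowP => -[].
rewrite linearN /= -mulmxN; congr (_ *m _); apply/matrixP => p q.
by rewrite !mxE exprS mulN1r mulNr.
Qed.

(** Suspension is the cone of the map to zero; the sign of the cone differential is absorbed by
    passing from [(-1)^i] to [(-1)^(i+1)]. *)
Lemma Cl_SigmaE_shift A i j : Cl A (E i j) -> Cl A (E i.+1 j).
Proof.
move=> ClE; have ClC := Cl_cone (zero_map (E i j) (zero_cx R)) ClE (Cl_zero A).
have f_lin n : linear (fun p : cone (zero_map (E i j) (zero_cx R)) n => unshift i j n p.2).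
  by move=> a p q; rewrite -linearP.
have f_comm n p : to_linear (f_lin n) (cd (cone (zero_map (E i j) (zero_cx R))) n p) =
    cd (E i.+1 j) n (to_linear (f_lin n.+1) p) by rewrite /= unshift_d.
apply: (@Cl_iso R A _ _ (ChainMap f_comm)) ClC => n.
  move=> [z s] [z' s'] /= /(can_inj (@unshiftK i j n)) ->.
  by congr pair; apply/rowP => -[].
by move=> x; exists (0, reshift i j n x); rewrite /= reshiftK.
Qed.

Lemma attach_comm i j n (x : E (i + j) 0 n.+1) :
  mulmxr (const_mx ((-1) ^+ i * r)) (cd (E (i + j) 0) n x) =
  cd (E i j) n (mulmxr (const_mx ((-1) ^+ i * r)) x).
Proof.
rewrite /= !mulmx_const2; apply: mulmx_const_eq.
by rewrite mulrACA hr mulr0 mulrACA hr mulr0 !mul0rn.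
Qed.

(** In degree [i + j] this sends a copy of [R] to the top module of [E i j]. Its cone gains a
    generator in degree [i + j + 1] whose differential is the one required in [E i j.+1]. *)
Definition attach i j : chain_map (E (i + j) 0) (E i j) :=
  @ChainMap R (E (i + j) 0) (E i j)
    (fun n => mulmxr (const_mx ((-1) ^+ i * r))) (@attach_comm i j).

Lemma mulmx_constD (m n : nat) (x : 'rV[R]_m) (a b : R) :
  x *m const_mx a + x *m const_mx b = x *m (const_mx (a + b) : 'M_(m, n)).
Proof. by rewrite -mulmxDr; congr (_ *m _); apply/matrixP => p q; rewrite !mxE. Qed.

Ltac degrees := rewrite /SE_dim; repeat case: ifP => ?; move=> *;
  rewrite ?mulr1n ?mulr0n; first [lia | ring | idtac].

Lemma Cl_SigmaE_attach A i j :
  Cl A (E (i + j) 0) -> Cl A (E i j) -> Cl A (E i j.+1).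
Proof.
move=> Cl0 ClE; have ClC := Cl_cone (attach i j) Cl0 ClE.
(* Here [const_mx 1] acts as the identity of [R] in degrees lying in both intervals and as zero
   elsewhere. *)
have f_lin n : linear (fun p : cone (attach i j) n =>
    p.1 *m const_mx 1 + unshift (i + j) 0 n p.2 *m const_mx 1 : E i j.+1 n).
  move=> a [y s] [y' s'] /=; rewrite linearP /= !mulmxDl -!scalemxAl scalerDr.
  by rewrite addrACA.
have f_comm n (p : cone (attach i j) n.+1) :
    to_linear (f_lin n) (cd (cone (attach i j)) n p) =
    cd (E i j.+1) n (to_linear (f_lin n.+1) p).
  case: p => y s; rewrite /= unshift_d /= !mulmxDl -!addrA !mulmx_const2 mulmx_constD.
  by congr (_ + _); apply: mulmx_const_eq; degrees.
apply: (@Cl_iso R A _ _ (ChainMap f_comm)) ClC => n /=.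
  apply: (can_inj (g := fun x => (x *m const_mx 1, reshift (i + j) 0 n (x *m const_mx 1)))).
  move=> [y s] /=; rewrite -[in RHS](unshiftK s).
  rewrite !mulmxDl !mulmx_const2; congr pair.
    rewrite (@mulmx_const_eq _ _ y _ 1) ?mulmx_const1 ?SE_dim_le1 //; last by degrees.
    rewrite (@mulmx_const_eq _ _ (unshift _ _ n s) _ 0) ?mulmx_const0 ?addr0 //.
    by degrees.
  congr (reshift (i + j) 0 n _); rewrite -[RHS]add0r; congr (_ + _).
    rewrite (@mulmx_const_eq _ _ y _ 0) ?mulmx_const0 //.
    by degrees.
  rewrite -[RHS](mulmx_const1 _ (SE_dim_le1 _ _ _)); apply: mulmx_const_eq.
  by degrees.
move=> x; exists (x *m const_mx 1, reshift (i + j) 0 n (x *m const_mx 1)).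
rewrite /= reshiftK !mulmx_const2 mulmx_constD.
rewrite -[RHS](mulmx_const1 _ (SE_dim_le1 _ _ _)); apply: mulmx_const_eq.
by degrees.
Qed.

Lemma transfer_comm i j n (x : E i j n.+1) :
  mulmxr (const_mx ((-1) ^+ n)) (cd (E i j) n x) =
  cd (E i.+1 j) n (mulmxr (const_mx ((-1) ^+ n.+1)) x).
Proof.
by rewrite /= !mulmx_const2; apply: mulmx_const_eq; rewrite !exprS; degrees.
Qed.

(* The identity in degrees [i+1 .. i+j], up to signs: its cone is equivalent to
   [Sigma^(i+1) R (+) Sigma^(i+j+1) R]. *)
Definition transfer i j : chain_map (E i j) (E i.+1 j) :=
  @ChainMap R (E i j) (E i.+1 j)
    (fun n => mulmxr (const_mx ((-1) ^+ n))) (@transfer_comm i j).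

Lemma Cl_SigmaE_unit A i j : Cl A (E i j) -> Cl A (E i.+1 0).
Proof.
move=> ClE; have ClC := Cl_cone (transfer i j) ClE (Cl_SigmaE_shift ClE).
(* The class split off is the suspended bottom generator of [E i j]; it is a cycle since [transfer]
   vanishes in degree [i]. *)
have e_lin n : linear (fun x : E i.+1 0 n =>
    ((0, reshift i j n (x *m const_mx 1)) : cone (transfer i j) n)).
  move=> a x y; congr pair; rewrite /= ?scaler0 ?addr0 //.
  by rewrite mulmxDl -scalemxAl linearP.
have e_comm n (x : E i.+1 0 n.+1) :
    to_linear (e_lin n) (cd (E i.+1 0) n x) =
    cd (cone (transfer i j)) n (to_linear (e_lin n.+1) x).
  rewrite /= /cone_d_fun /=; congr pair.
    rewrite mul0mx add0r mulmx_const2 -(mulmx_const0 _ x).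
    by apply: mulmx_const_eq; degrees.
  apply: (can_inj (@unshiftK i j n)); rewrite reshiftK unshift_d /= !mulmx_const2.
  by apply: mulmx_const_eq; degrees.
(* The generator of degree [i + 2] coming from the suspended source has boundary with components
   [(-1)^(i+1)] and [(-1)^(i+1) r]; the coefficient [- r] makes the projection kill it. *)
have p_lin n : linear (fun c : cone (transfer i j) n =>
    unshift i j n c.2 *m const_mx 1 + c.1 *m const_mx (- r) : E i.+1 0 n).
  move=> a [y s] [y' s'] /=; rewrite linearP /= !mulmxDl -!scalemxAl scalerDr.
  by rewrite addrACA.
have p_comm n (c : cone (transfer i j) n.+1) :
    to_linear (p_lin n) (cd (cone (transfer i j)) n c) =
    cd (E i.+1 0) n (to_linear (p_lin n.+1) c).
  case: c => y s; rewrite /= unshift_d /= !mulmxDl !mulmx_const2 (addrC (y *m _)).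
  rewrite addrA mulmx_constD; congr (_ + _); apply: mulmx_const_eq.
    have eqn : (0 < SE_dim i.+1 0 n)%N -> n = i.+1 by degrees.
    by move=> _ /eqn ->; degrees.
  by rewrite mulrN mulNr mulrCA -mulrA hr mulr0 oppr0 !mul0rn.
apply: (@Cl_retract R A _ _ (ChainMap e_comm) (ChainMap p_comm)) ClC => n x /=.
rewrite reshiftK mulmx_const2 mul0mx addr0.
rewrite -[RHS](mulmx_const1 _ (SE_dim_le1 _ _ _)); apply: mulmx_const_eq.
by degrees.
Qed.

Lemma Cl_SigmaE i j i' j' : lexle (i, j) (i', j') -> Cl (E i j) (E i' j').
Proof.
have unit_lt k l m : (k < l)%N -> Cl (E k m) (E l 0).
  elim: l => // l IH; rewrite ltnS leq_eqVlt => /orP[/eqP <-|/IH].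
    exact: Cl_SigmaE_unit (Cl_base _).
  exact: Cl_SigmaE_shift.
(* The copy of [R] needed for attaching lies in degree [k + m]: for [m = 0] it is [E k 0] itself,
   otherwise [k < k + m] and [unit_lt] supplies it. *)
have attachC k m : Cl (E k m) (E k m.+1).
  apply: Cl_SigmaE_attach (Cl_base _).
  case: m => [|m]; first by rewrite addn0; exact: Cl_base.
  by apply: unit_lt; rewrite addnS ltnS leq_addr.
have grow k l m : (l <= m)%N -> Cl (E k l) (E k m).
  elim: m => [|m IH]; first by rewrite leqn0 => /eqP ->; exact: Cl_base.
  rewrite leq_eqVlt => /orP[/eqP ->|]; first exact: Cl_base.
  by rewrite ltnS => /IH ClE; apply: Cl_trans ClE _.
case/orP => /= [lti|/andP[/eqP <-]]; last exact: grow.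
by apply: Cl_trans (unit_lt _ _ j lti) _; exact: grow.
Qed.
End Intervals.

(** * Coordinates in direct sums *)

Section DirectSums.
Variable R : comUnitRingType.

(** Generation in [is_direct_sum] allows repeated indices, whereas independence concerns
    duplicate-free lists. Repetitions are merged by scaling each component by its multiplicity, with
    classical equality on [I]. *)
Lemma sum_NoDup (I : Type) (V : lmodType R) (F : I -> lmodType R)
    (g : forall k, {linear F k -> V}) (ks : seq I) (x : forall k, F k) :
  exists (ks' : seq I) (x' : forall k, F k),
    List.NoDup ks' /\ \sum_(k <- ks) g k (x k) = \sum_(k <- ks') g k (x' k).
Proof.
pose J : choiceType := {classic I}.
exists (undup (ks : seq J)), (fun k => x k *+ count_mem (k : J) ks).
split; first by apply/(@NoDup_uniq J); exact: undup_uniq.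
rewrite -(@big_undup_iterop_count _ _ _ J ks xpredT (fun k => g k (x k))).
by apply: eq_bigr => k _; rewrite linearMn.
Qed.

(** Independence makes coordinates unique, so coordinates picked by choice are automatically linear
    and commute with the differentials. *)
Lemma direct_sum_proj (I : finType) (Y : complex R) (F : I -> complex R) (k0 : I) :
  is_direct_sum Y F ->
  exists (e : chain_map (F k0) Y) (p : chain_map Y (F k0)),
    forall n x, p n (e n x) = x.
Proof.
case=> iota [gen free]; exists (iota k0).
pose S n (x : forall k, F k n) := \sum_k iota k n (x k).
have S_lin n a (x y : forall k, F k n) :
    S n (fun k => a *: x k + y k) = a *: S n x + S n y.
  by rewrite /S scaler_sumr -big_split; apply: eq_bigr => k _; rewrite linearP.
have S_inj n x y : S n x = S n y -> forall k, x k = y k.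
  move=> Sxy k; apply/eqP; rewrite -subr_eq0; apply/eqP.
  apply: (free n (index_enum I) (fun k => x k - y k)).
  - by apply/NoDup_uniq; exact: index_enum_uniq.
  - by under eq_bigr do rewrite linearB; rewrite sumrB; apply/eqP; rewrite subr_eq0; apply/eqP.
  - by apply/In_mem; rewrite mem_index_enum.
have repr n y : {x | y = S n x}.
  apply: cid; have [ks [x ->]] := gen n y.
  exists (fun k => x k *+ count_mem k ks).
  rewrite -(@big_undup_iterop_count _ _ _ I ks xpredT (fun k => iota k n (x k))).
  rewrite /S [RHS](bigID (mem ks)) /= [X in _ = _ + X]big1 ?addr0; last first.
    by move=> k /count_memPn ->; rewrite mulr0n linear0.
  rewrite -[RHS]big_filter; under [RHS]eq_bigr do rewrite linearMn.
  apply: perm_big; apply: uniq_perm; rewrite ?undup_uniq ?filter_uniq ?index_enum_uniq //.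
  by move=> k; rewrite mem_undup mem_filter mem_index_enum andbT.
pose p n y := sval (repr n y) k0.
have pE n x : p n (S n x) = x k0 by rewrite /p; case: (repr _ _) => z /= /S_inj ->.
have p_lin n : linear (p n).
  move=> a y z; rewrite {1}(svalP (repr n y)) {1}(svalP (repr n z)).
  by rewrite -S_lin pE.
have p_comm n (y : Y n.+1) :
    to_linear (p_lin n) (cd Y n y) = cd (F k0) n (to_linear (p_lin n.+1) y).
  rewrite /= {1}(svalP (repr _ y)) /S linear_sum /=.
  by under eq_bigr do rewrite -cm_comm; exact: pE n (fun k => cd (F k) n _).
exists (ChainMap p_comm) => n x /=.
(* The family with value [x] at [k0] and zero elsewhere; the cast transports [x] along [k = k0]. *)
pose x' k : F k n := if k =P k0 is ReflectT e then ecast k (F k n) (esym e) x else 0.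
have -> : iota k0 n x = S n x'.
  rewrite /S (bigD1 k0) //= [X in _ + X]big1 => [|k /negPf kk0].
    by rewrite addr0 /x'; case: eqP => // e; rewrite (eq_axiomK e).
  by rewrite /x'; case: eqP kk0 => // e; rewrite linear0.
by rewrite pE /x'; case: eqP => // e; rewrite (eq_axiomK e).
Qed.
End DirectSums.

(** * The chain-lifting invariant of members of [Cl] *)

Section Chains.
Variables (R : comUnitRingType) (r : R) (hr : r * r = 0).
Local Notation E := (SigmaE hr).
Implicit Types X Y Z : complex R.

(* [starts_chain X j x]: up to the unit signs, [x] is the image of the bottom
   generator under a chain map [Sigma^n E_j -> X]. *)
Fixpoint starts_chain X j n (x : X n) : Prop :=
  if j is l.+1 then exists y : X n.+1, cd X n y = r *: x /\ starts_chain l y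
  else True.

Lemma starts_chainD X j n (x y : X n) :
  starts_chain j x -> starts_chain j y -> starts_chain j (x + y).
Proof.
elim: j n x y => //= j IH n x y [x' [dx chx]] [y' [dy chy]].
by exists (x' + y'); rewrite linearD dx dy scalerDr; split; last exact: IH.
Qed.

Lemma starts_chain_map X Y (f : chain_map X Y) j n (x : X n) :
  starts_chain j x -> starts_chain j (f n x).
Proof.
elim: j n x => //= j IH n x [y [dy chy]].
by exists (f n.+1 y); rewrite -cm_comm dy linearZ; split; last exact: IH.
Qed.

(** As [r^2 = 0], the chain can continue with [0], which is again a multiple of [r]. *)
Lemma starts_chain_scaled X j n (x : X n) : starts_chain j (r *: x).
Proof.
elim: j n x => //= j IH n x; exists 0.
split; first by rewrite linear0 scalerA hr scale0r.
by rewrite -(scaler0 _ r); exact: IH.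
Qed.

Lemma starts_chain_boundary X j n (x : X n) : is_boundary x -> starts_chain j x.
Proof.
case: j => //= j [z <-]; exists (r *: z); rewrite linearZ; split => //.
exact: starts_chain_scaled.
Qed.

Lemma starts_chain_sum (I : Type) X j n (ks : seq I) (x : I -> X n) :
  (forall k, List.In k ks -> starts_chain j (x k)) ->
  starts_chain j (\sum_(k <- ks) x k).
Proof.
elim: ks => [_|k ks IH chx].
  by rewrite big_nil -(scaler0 _ r); exact: starts_chain_scaled.
rewrite big_cons; apply: starts_chainD; first by apply: chx; left.
by apply: IH => l lks; apply: chx; right.
Qed.

(* Obstruction theory for the cofibrant complex [E_j]: a map [E_j -> Y] lifts
   through a weak equivalence [X -> Y], one degree at a time. *)
Lemma starts_chain_weq X Y (f : chain_map X Y) j n (x : X n) :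
  weak_equiv f -> is_cycle (r *: x) -> starts_chain j (f n x) -> starts_chain j x.
Proof.
move=> wf; elim: j n x => //= j IH n x crx [y [dy chy]].
have [|x1 dx1] := (wf n).1 _ crx; first by exists y; rewrite dy linearZ.
(* The lift [x1] need not map to [y], but [f x1 - y] is a cycle. Subtracting a cycle [c]
   representing its class leaves only a boundary, which starts chains of every length. *)
have [|c [/= dc [z dz]]] := (wf n.+1).2 (f n.+1 x1 - y).
  by rewrite /= linearB -cm_comm dx1 linearZ dy subrr.
exists (x1 - c); split; first by rewrite linearB dx1 dc subr0.
apply: IH; first by rewrite /= linearZ /= linearB dx1 dc subr0 scalerA hr scale0r.
have -> : f n.+1 (x1 - c) = y + cd Y n.+1 (- z).
  by rewrite linearN dz linearB opprB addrA [y + _]addrC subrK.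
by apply: starts_chainD => //; apply: starts_chain_boundary; exists (- z).
Qed.

(** The first clause is what lets cycles of degree [i] lift through a quotient, so that the second
    passes to cokernels. *)
Definition chain_connected i j X : Prop :=
  (forall n (x : X n), (n < i)%N -> is_cycle x -> is_boundary x) /\
  (forall x : X i, is_cycle x -> starts_chain j x).

Lemma is_cycle_map X Y (f : chain_map X Y) n (x : X n) : is_cycle x -> is_cycle (f n x).
Proof. by case: n x => //= n x dx; rewrite -cm_comm dx linear0. Qed.

Lemma is_cycleZ X n a (x : X n) : is_cycle x -> is_cycle (a *: x).
Proof. by case: n x => //= n x dx; rewrite linearZ /= dx scaler0. Qed.

Lemma is_boundaryD X n (x y : X n) : is_boundary x -> is_boundary y -> is_boundary (x + y).
Proof. by move=> [z <-] [w <-]; exists (z + w); rewrite linearD. Qed.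

Lemma is_boundary_map X Y (f : chain_map X Y) n (x : X n) :
  is_boundary x -> is_boundary (f n x).
Proof. by move=> [z <-]; exists (f n.+1 z); rewrite cm_comm. Qed.

Lemma chain_connected_sum i j Y (I : Type) (F : I -> complex R) :
  is_direct_sum Y F -> (forall k, chain_connected i j (F k)) -> chain_connected i j Y.
Proof.
move=> [iota [gen free]] Fij.
(* After merging repeated indices, independence forces each component of a cycle to be a cycle. *)
have repr n (y : Y n) : is_cycle y -> exists (ks : seq I) (x : forall k, F k n),
    y = \sum_(k <- ks) iota k n (x k) /\ forall k, List.In k ks -> is_cycle (x k).
  have [ks [x ->]] := gen n y.
  have [ks' [x' [nd ->]]] := sum_NoDup (fun k => iota k n) ks x.
  exists ks', x'; split => //.
  case: n {ks x y} x' H => // n x'; rewrite /= linear_sum /= => dx.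
  apply: (free n ks' (fun k => cd (F k) n (x' k)) nd); rewrite -[RHS]dx.
  by apply: eq_bigr => k _; rewrite cm_comm.
split=> [n y ltni|y] /repr[ks [x [-> cx]]].
  elim: ks cx => [_|k ks IH cx]; first by rewrite big_nil; exists 0; rewrite linear0.
  rewrite big_cons; apply: is_boundaryD; last by apply: IH => l lks; apply: cx; right.
  by apply: is_boundary_map; apply: (Fij k).1 => //; apply: cx; left.
apply: starts_chain_sum => k /cx cxk; apply: starts_chain_map.
exact: (Fij k).2.
Qed.

Lemma chain_connected_weq_fwd i j X Y (f : chain_map X Y) :
  weak_equiv f -> chain_connected i j X -> chain_connected i j Y.
Proof.
move=> wf [acX chX]; split=> [n y ltni|y] /(wf _).2[x [cx [z dz]]].
  rewrite (_ : y = f n x + cd Y n (- z)); last by rewrite linearN dz opprB addrC subrK.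
  apply: is_boundaryD; last by exists (- z).
  by apply: is_boundary_map; exact: acX.
rewrite (_ : y = f i x + cd Y i (- z)); last by rewrite linearN dz opprB addrC subrK.
apply: starts_chainD; last by apply: starts_chain_boundary; exists (- z).
by apply: starts_chain_map; exact: chX.
Qed.

Lemma chain_connected_weq_bwd i j X Y (f : chain_map X Y) :
  weak_equiv f -> chain_connected i j Y -> chain_connected i j X.
Proof.
move=> wf [acY chY]; split=> [n x ltni cx|x cx].
  by apply: (wf n).1 => //; apply: acY => //; exact: is_cycle_map.
apply: (starts_chain_weq wf); first exact: is_cycleZ.
by apply: chY; exact: is_cycle_map.
Qed.

(** The obstruction to lifting a cycle of [Z] of degree [n <= i] to a cycle of [Y] is a homology
    class of [X] in degree [n - 1], which vanishes. *)
Lemma chain_connected_coker i j X Y Z (f : chain_map X Y) (g : chain_map Y Z) :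
  short_exact f g -> chain_connected i j X -> chain_connected i j Y ->
  chain_connected i j Z.
Proof.
move=> fg [acX _] [acY chY].
have lift n (z : Z n) : (n <= i)%N -> is_cycle z -> exists2 y, is_cycle y & g n y = z.
  have [y gy] := (fg n).2.1 z; case: n z y gy => [|n] z y gy lti /= dz; first by exists y.
  have [x fx] : exists x, f n x = cd Y n y by apply/(fg n).2.2; rewrite cm_comm gy.
  have cx : is_cycle x.
    case: n {z dz} y lti x fx {gy} => //= n y _ x fx; apply: (fg n).1.
    by rewrite cm_comm fx cdd linear0.
  have [w dw] := acX n x lti cx; exists (y - f n.+1 w).
    by rewrite /= linearB -cm_comm dw fx subrr.
  rewrite linearB gy (_ : g n.+1 (f n.+1 w) = 0) ?subr0 //.
  by apply/(fg n.+1).2.2; exists w.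
split=> [n z ltni cz|z cz].
  by have [y cy <-] := lift n z (ltnW ltni) cz; apply: is_boundary_map; exact: acY.
have [y cy <-] := lift i z (leqnn i) cz.
by apply: starts_chain_map; exact: chY.
Qed.

Lemma chain_connected_Cl i j A Y :
  Cl A Y -> chain_connected i j A -> chain_connected i j Y.
Proof.
move=> + Aij; elim=> //.
- by move=> Y' I F sumF _ IH; exact: chain_connected_sum sumF IH.
- by move=> X' Y' f wf _; exact: chain_connected_weq_fwd.
- by move=> X' Y' f wf _; exact: chain_connected_weq_bwd.
- by move=> X' Y' Z' f g fg _ IHX _ IHY; exact: chain_connected_coker fg IHX IHY.
Qed.

Lemma SE_obj0 i j n (x : E i j n) : ~~ (i <= n <= i + j)%N -> x = 0.
Proof.
by rewrite /= /SE_dim in x *; move: x => /[swap] /negPf -> x; apply/rowP => -[].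
Qed.

Lemma starts_chain_SigmaE i j l n (x : E i j n) :
  (i <= n)%N -> (n + l <= i + j)%N -> starts_chain l x.
Proof.
elim: l n x => //= l IH n x lein lenl.
(* The sign cancels the [(-1)^i] of the differential, leaving exactly [r]. *)
exists (x *m const_mx ((-1) ^+ i)); split; last by apply: IH; lia.
rewrite mulmx_const2 (_ : r *: x = x *m const_mx r).
  apply: mulmx_const_eq => _ _; rewrite /SE_dim; case: ifP => [_|]; last by lia.
  by rewrite mulr1n mulrA -exprMn mulrNN mulr1 expr1n mul1r.
rewrite -{1}(mulmx_const1 x (SE_dim_le1 _ _ _)) scalemxAr; congr (_ *m _).
by apply/matrixP => p q; rewrite !mxE mulr1.
Qed.

Lemma chain_connected_SigmaE i j : chain_connected i j (E i j).
Proof.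
split=> [n x ltni _|x _]; last exact: starts_chain_SigmaE.
by exists 0; rewrite linear0 [RHS]SE_obj0 // leqNgt ltni.
Qed.

(** If [d y = r x] is nonzero then so is [r y], since [d y] is [r y] up to sign. The chain would
    thus stay nonzero beyond the top degree [i + j]. *)
Lemma no_long_chain i j l n (x : E i j n) :
  (i + j < n + l)%N -> r *: x != 0 -> ~ starts_chain l x.
Proof.
elim: l n x => [|l IH] n x lt rx /=.
  by rewrite (SE_obj0 x) ?scaler0 ?eqxx // in rx; lia.
move=> [y [dy /IH]]; apply; first lia.
apply: contra_neq rx => ry; rewrite -dy /=.
have -> : const_mx ((-1) ^+ i * r) = r *: const_mx ((-1) ^+ i) :> 'M[R]_(_, _).
  by move=> p q; apply/matrixP => s t; rewrite !mxE mulrC.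
by rewrite -scalemxAr scalemxAl ry mul0mx.
Qed.

Hypothesis hr0 : r != 0.

Lemma chain_connected_lexle i j i' j' :
  chain_connected i j (E i' j') -> lexle (i, j) (i', j').
Proof.
move=> [ac ch]; rewrite /lexle /=.
pose one : E i' j' i' := const_mx 1.
have one_cycle : is_cycle one.
  rewrite /one; case: (i') => //= k; apply: SE_obj0; lia.
have r_one : r *: one != 0.
  have d1 : SE_dim i' j' i' = 1%N by rewrite /SE_dim leqnn leq_addr.
  apply/eqP => /matrixP /(_ 0 (cast_ord (esym d1) 0)).
  by rewrite !mxE mulr1; apply/eqP.
case: ltngtP => //= [lti|eqi].
  (* Boundaries are multiples of [r], hence killed by [r], unlike the bottom generator. *)
  have [z dz] := ac _ one lti one_cycle; case/eqP: r_one.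
  rewrite -dz SE_dE scalemxAr (_ : r *: const_mx _ = 0) ?mulmx0 //.
  by apply/matrixP => p q; rewrite !mxE mulrCA hr mulr0.
rewrite leqNgt; apply/negP => ltj; subst i'.
apply: (no_long_chain (l := j) _ r_one); first by rewrite ltn_add2l.
exact: ch.
Qed.

End Chains.

Theorem theorem6p3 (R : comUnitRingType) (r : R)
  (hloc : forall x : R, x \notin GRing.unit <-> exists a : R, x = a * r)
  (hr : r * r = 0) (hr0 : r != 0) :
  (forall i j i' j' : nat,
     Cl (SigmaE hr i j) (SigmaE hr i' j') <-> lexle (i, j) (i', j'))
  /\
  (forall X : complex R, perfect X ->
     (contractible X -> forall Y, Cl X Y <-> Cl (zero_cx R) Y) /\
     (forall (P : complex R) (s : seq (nat * nat)),
        acyclic P ->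
        is_direct_sum X (fun o : option 'I_(size s) =>
           match o with
           | None => P
           | Some k => SigmaE hr (nth (0, 0)%N s k).1 (nth (0, 0)%N s k).2
           end) ->
        forall i0 j0 : nat, (i0, j0) \in s ->
        (forall p, p \in s -> lexle (i0, j0) p) ->
        ~ contractible X ->
        forall Y, Cl X Y <-> Cl (SigmaE hr i0 j0) Y)).
Proof.
split=> [i j i' j'|X _].
  split; last exact: Cl_SigmaE.
  move=> ClE; apply: (@chain_connected_lexle R r hr hr0).
  exact: (chain_connected_Cl hr ClE (chain_connected_SigmaE hr i j)).
split=> [ctX Y|P s acP sumX i0 j0 s0 min0 _ Y].
  split; apply: Cl_trans; last exact: Cl_zero.
  exact/Cl_acyclic/contractible_acyclic.
split; apply: Cl_trans.
  (* By minimality every interval summand lies in [Cl] of the minimal one, and so does the acyclic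
     [P]. *)
  apply: (Cl_sum sumX) => -[k|]; last exact: Cl_acyclic.
  by apply: Cl_SigmaE; rewrite -surjective_pairing; apply/min0/mem_nth.
(* Conversely, the minimal pair occurs in [s], so its complex is a retract of [X]. *)
have lt0 : (index (i0, j0) s < size s)%N by rewrite index_mem.
have [e [p pe]] := direct_sum_proj (Some (Ordinal lt0)) sumX.
move: e p pe; rewrite /= nth_index //= => e p pe.
exact: (@Cl_retract R X _ X e p pe (Cl_base X)).
Qed.
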